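(* Let $M\ge2$ be an integer and $1<c<M$ (so that $\gamma=\frac{\log c}{\log(M/c)}>0$), and put $b=\frac{M^2-c}{M(M-1)}$ and $D=\frac{M-1}{Mb}\,\frac{c}{c-1}$. Let $X$ be the centered Gaussian process with values in $\mathcal B_b'$ with covariance $$E\langle X(s),\varphi\rangle\langle X(t),\psi\rangle=2(s\wedge t)\langle G\varphi,\psi\rangle,\quad s,t\ge0,\ \varphi,\psi\in\mathcal B_b,$$ where $G$ is the potential operator of the $c$-random walk on $\Omega_M$. Denote $$\widetilde\vartheta_t=\langle X(1),\mathbf 1_{B_t}\rangle,\quad t=0,1,2,\dots,$$ where $B_n$ is the ball in $\Omega_M$ with center $0$ and radius $n$. Then $\widetilde\vartheta$ is a centered Gaussian process with covariance $$E\widetilde\vartheta_s\widetilde\vartheta_t=2D\,M^{s\wedge t}\left(\frac Mc\right)^{s\vee t},\quad s,t=0,1,2,\dots$$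
   Context: **Hierarchical group.** For an integer $M\ge2$, $\Omega_M=\{x=(x_1,x_2,\dots):x_i\in\{0,1,\dots,M-1\},\ \sum_i x_i<\infty\}$ with componentwise addition mod $M$ and hierarchical distance $|x-y|=0$ if $x=y$, $|x-y|=\max\{i:x_i\ne y_i\}$ otherwise; $B_n=\{x\in\Omega_M:|x|\le n\}$. $\mathcal B_b$ is the space of real functions on $\Omega_M$ with bounded (equivalently, finite) support, $\mathcal B_b'$ its dual, and $\langle f,\psi\rangle=\sum_{x\in\Omega_M}f(x)\psi(x)$ for a function $f$ on $\Omega_M$ and $\psi\in\mathcal B_b$. **$c$-random walk** ($0<c<M$). The continuous-time random walk on $\Omega_M$ with jump rate $1$; at each jump a distance $j\in\{1,2,\dots\}$ is chosen with probability $r_j=(1-\frac cM)(\frac cM)^{j-1}$, and the walk moves to a point chosen uniformly among all points at distance $j$ from its current position. With $p_t(x,y)$ its transition probabilities, $\mathcal T_t\varphi(x)=\sum_y p_t(x,y)\varphi(y)$, and the potential operator is $G\varphi(x)=\int_0^\infty\mathcal T_t\varphi(x)\,dt$, which is finite for $c>1$. The process $X$ is the limit in the sense of finite-dimensional distributions, as $T\to\infty$, of $T^{-1/2}\int_0^{Tt}(N_r-EN_r)\,dr$, where $N$ is the empirical process of a system of independent $c$-random walks started from i.i.d. Poisson numbers of particles with mean $1$ at the sites of $\Omega_M$. *)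

(* Defs.v *)
From HB Require Import structures.
From mathcomp Require Import all_boot all_order all_algebra finmap.
From mathcomp Require Import all_classical all_reals all_analysis.

Set Implicit Arguments.
Unset Strict Implicit.
Unset Printing Implicit Defensive.

Import Order.TTheory GRing.Theory Num.Theory.
Import numFieldNormedType.Exports.

Local Open Scope classical_set_scope.
Local Open Scope ring_scope.

(* Polynomials over Z/M are the finitely supported sequences with entries in
   {0, ..., M-1}, added componentwise mod M; multiplication is never used.
   The coefficient x`_i is the (i+1)-st coordinate of x, coordinates being
   numbered from 1 in the definition of Omega_M.  'Z_M is Z/M only for M >= 2. *)
Notation Omega M := {poly 'Z_M}.

(* Coordinates beyond both sizes vanish, hence agree, so this is the largest
   (1-based) index of a coordinate at which x and y differ, and 0 if x = y. *)
Definition hdist (M : nat) (x y : Omega M) : nat :=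
  \max_(i < maxn (size x) (size y) | x`_i != y`_i) i.+1.

Definition hball (M n : nat) : set (Omega M) :=
  [set x | (hdist x 0%R <= n)%N].
Arguments hball : clear implicits.

Section TestFunctions.
Context (R : realType) (M : nat).

Definition bounded_support : {pred Omega M -> R} :=
  fun f => `[< exists n, forall x, f x != 0 -> hball M n x >].

Lemma bounded_support_submod_closed : submod_closed bounded_support.
Proof.
split; first by apply/asboolP; exists 0%N => x; rewrite eqxx.
move=> a f g /asboolP[m fm] /asboolP[n gn]; apply/asboolP.
exists (maxn m n) => x; have [fx0|/fm] := eqVneq (f x) 0; last first.
  by rewrite /hball/= leq_max => ->.
have [gx0|/gn] := eqVneq (g x) 0; last by rewrite /hball/= leq_max => ->; rewrite orbT.
by rewrite -[(a *: f + g) x]/(a *: f x + g x) fx0 gx0 scaler0 addr0 eqxx.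
Qed.

HB.instance Definition _ := GRing.isSubmodClosed.Build R (Omega M -> R)
  bounded_support bounded_support_submod_closed.

Record Bb := MkBb { Bb_fun :> Omega M -> R ; _ : Bb_fun \in bounded_support }.

HB.instance Definition _ := [isSub for Bb_fun].
HB.instance Definition _ := [Choice of Bb by <:].
HB.instance Definition _ := [SubChoice_isSubLmodule of Bb by <:].

Lemma indic_hball_bounded (n : nat) : \1_(hball M n) \in bounded_support.
Proof.
apply/asboolP; exists n => x; rewrite indicE.
by case: (boolP (x \in hball M n)) => [/set_mem//|_]; rewrite eqxx.
Qed.

Definition indic_hball (n : nat) : Bb := MkBb (indic_hball_bounded n).

(* The algebraic dual, i.e. all of R^Omega: on the direct sum B_b, with its
   inductive limit topology, every linear form is continuous. *)
Definition Bb_dual := {linear Bb -> R^o}.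

Definition pairing (f : Omega M -> R) (psi : Bb) : R :=
  \sum_(x \in [set: Omega M]) f x * psi x.

End TestFunctions.

Section RandomWalk.
Context (R : realType) (M : nat) (c : R).
Implicit Types (x y : Omega M) (n : nat) (t : R).

Definition jump_dist_prob (j : nat) : R :=
  (1 - c / M%:R) * (c / M%:R) ^+ j.-1.

Definition jump_prob x y : R :=
  if x == y then 0 else
  jump_dist_prob (hdist x y) / #|` fset_set [set z | hdist x z = hdist x y] |%:R.

Fixpoint jump_prob_iter n x y : \bar R :=
  if n is n'.+1
  then (\esum_(z in [set: Omega M]) ((jump_prob x z)%:E * jump_prob_iter n' z y))%E
  else ((x == y)%:R)%:E.

(* The number of jumps up to time t is Poisson with mean t (jump rate 1);
   poisson_pmf is avoided because it is not a probability at t = 0. *)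
Definition transition_prob t x y : R :=
  fine (\sum_(0 <= n <oo)
    ((expR (- t) * (t ^+ n / n`!%:R))%:E * jump_prob_iter n x y))%E.

Definition semigroup t (phi : Bb R M) x : R :=
  \sum_(y \in [set: Omega M]) transition_prob t x y * phi y.

Definition potential (phi : Bb R M) x : R :=
  \int[lebesgue_measure]_(t in `[0, +oo[) semigroup t phi x.

End RandomWalk.

Section GaussianProcess.
Context d (T : measurableType d) (R : realType) (P : probability T R).

(* sigma = 0 is the degenerate law; normal_prob m 0 is a junk value. *)
Definition gaussian_law (m sigma : R) : set R -> \bar R :=
  if sigma == 0 then \d_m else normal_prob m sigma.

Definition gaussian_rv (Y : T -> R) : Prop :=
  measurable_fun [set: T] Y /\
  exists m sigma : R, forall A : set R, measurable A ->
    P (Y @^-1` A) = gaussian_law m sigma A.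

Definition gaussian_process (I : Type) (Y : I -> T -> R) : Prop :=
  forall (n : nat) (i : 'I_n -> I) (a : 'I_n -> R),
    gaussian_rv (fun w => \sum_(k < n) a k * Y (i k) w).

Definition centered_gaussian_process (I : Type) (Y : I -> T -> R) : Prop :=
  gaussian_process Y /\ forall i, ('E_P[Y i] = 0)%E.

(* A B_b'-valued process is Gaussian when the real random variables
   <X(t), phi>, over all t >= 0 and phi in B_b, are jointly Gaussian. *)
Definition centered_gaussian_dual_process (M : nat)
    (X : {nonneg R} -> T -> Bb_dual R M) : Prop :=
  centered_gaussian_process
    (fun (i : {nonneg R} * Bb R M) w => X i.1 w i.2).

End GaussianProcess.

(* Main.v *)
(* Write q = c/M, b = (M^2 - c)/(M(M-1)), and let P be the one-jump operator of
   the walk.  By the ultrametric inequality, M 1_{B_s} - 1_{B_{s+1}} is an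
   eigenvector of P with eigenvalue 1 - b q^s, hence of the semigroup, with
   eigenvalue exp(-t b q^s).  Let H_s(t) be the sum of the semigroup applied to
   1_{B_s} over B_m.  Since H_s(t) / M^s tends to 0, telescoping gives
     H_s(t) = M^s sum_{k >= max(s,m)} (M-1) M^(m-k-1) exp(-t b q^k),
   and integrating over t leaves a geometric series of ratio 1/c. *)
Require Import Defs.
From HB Require Import structures.
From mathcomp Require Import all_boot all_order all_algebra finmap.
From mathcomp Require Import all_classical all_reals all_analysis.
From mathcomp Require Import measurable_realfun ring lra.

Set Implicit Arguments.
Unset Strict Implicit.
Unset Printing Implicit Defensive.

Import Order.TTheory GRing.Theory Num.Theory.
Import numFieldNormedType.Exports.

Local Open Scope classical_set_scope.
Local Open Scope ring_scope.

(** * Ultrametric balls and spheres *)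

(** The leading coefficient of [y - x] sits at the last coordinate where [x] and [y] differ, and
    [size] counts from 1 as [hdist] does. The ultrametric inequality thus becomes the bound on the
    size of a sum. *)
Lemma hdistE (M : nat) (x y : Omega M) : hdist x y = size (y - x).
Proof.
apply/eqP; rewrite eqn_leq; apply/andP; split.
  apply/bigmax_leqP => i neq; rewrite ltnNge; apply: contra neq => le_i.
  by rewrite eq_sym -subr_eq0 -coefB nth_default.
apply/leq_sizeP => j; rewrite /hdist => le_j.
have [lt_j|ge_j] := ltnP j (maxn (size x) (size y)); last first.
  by rewrite coefB !nth_default ?subrr//; move: ge_j; rewrite geq_max => /andP[].
apply/eqP; rewrite coefB subr_eq0 eq_sym; apply: contraLR le_j => neq.
by rewrite -ltnNge (bigop.bigmax_sup (Ordinal lt_j)).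
Qed.

Lemma hdistC (M : nat) (x y : Omega M) : hdist x y = hdist y x.
Proof. by rewrite !hdistE -(size_polyN (y - x)) opprB. Qed.

Lemma hdist_eq0 (M : nat) (x y : Omega M) : (hdist x y == 0%N) = (x == y).
Proof. by rewrite hdistE size_poly_eq0 subr_eq0 eq_sym. Qed.

Lemma hdist_ultra (M : nat) (x y z : Omega M) :
  (hdist x z <= maxn (hdist x y) (hdist y z))%N.
Proof. by rewrite !hdistE maxnC -[z - x](subrKA y) size_polyD. Qed.

(** Triangles are isosceles: in the ultrametric inequality for [x], [z], [y], the side [hdist z y]
    is too short to bound [hdist x y]. *)
Lemma hdist_ultra_eq (M : nat) (x y z : Omega M) :
  (hdist y z < hdist x y)%N -> hdist x z = hdist x y.
Proof.
move=> lt_yz; apply/eqP; rewrite eqn_leq.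
have := hdist_ultra x y z; rewrite (maxn_idPl (ltnW lt_yz)) => -> /=.
have := hdist_ultra x z y; rewrite (hdistC z y) leq_max => /orP[//|].
by rewrite leqNgt lt_yz.
Qed.

(** Balls as finite sets, for use in [\sum]; the parametrization by row vectors gives their
    cardinality. *)
Definition hcball (M : nat) (x : Omega M) (n : nat) : {fset Omega M} :=
  [fset (x + rVpoly u)%R | u in 'rV['Z_M]_n]%fset.

Lemma in_hcball (M : nat) (x y : Omega M) (n : nat) :
  (y \in hcball x n) = (hdist x y <= n)%N.
Proof.
rewrite hdistE; apply/imfsetP/idP => /= [[u _ ->]|le_n].
  by rewrite addrC addKr size_poly.
by exists (poly_rV (y - x)) => //; rewrite poly_rV_K// addrC subrK.
Qed.

Lemma card_hcball (M : nat) (x : Omega M) (n : nat) :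
  (2 <= M)%N -> #|` hcball x n| = (M ^ n)%N.
Proof.
move=> M2; rewrite card_imfset/=; last first.
  by move=> u v /addrI /(can_inj (@rVpolyK _ _)).
rewrite -cardE card_mx mul1n card_ord.
(* ['Z_M] has [(Zp_trunc M).+2] elements, which is [M] because [2 <= M]. *)
by rewrite Zp_cast.
Qed.

(** In an ultrametric space every point of a ball is a center of it. *)
Lemma hcball_eq (M : nat) (x y : Omega M) (n : nat) :
  (hdist x y <= n)%N -> hcball x n = hcball y n.
Proof.
move=> xy; apply/fsetP => z; rewrite !in_hcball; apply/idP/idP => h.
  by rewrite (leq_trans (hdist_ultra _ x _))// geq_max hdistC xy.
by rewrite (leq_trans (hdist_ultra _ y _))// geq_max xy.
Qed.

Lemma hsphereE (M : nat) (x : Omega M) (n : nat) :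
  fset_set [set z | hdist x z = n.+1] = (hcball x n.+1 `\` hcball x n)%fset.
Proof.
(* Membership in [fset_set] is meaningful only for a finite set; the sphere lies in a finite
   ball. *)
apply/fsetP => z; rewrite in_fset_set; last first.
  apply: (sub_finite_set _ (finite_fset (hcball x n.+1))) => y /= yx.
  by rewrite in_hcball yx.
rewrite in_fsetD !in_hcball -ltnNge.
apply/idP/idP => [/set_mem/= ->|h]; first by rewrite !leqnn.
by apply/mem_set/eqP; rewrite eqn_leq andbC.
Qed.

Lemma hcball_sub (M : nat) (x : Omega M) (m n : nat) :
  (m <= n)%N -> (hcball x m `<=` hcball x n)%fset.
Proof. by move=> mn; apply/fsubsetP => z; rewrite !in_hcball => /leq_trans; exact. Qed.

Lemma card_hsphere (M : nat) (x : Omega M) (n : nat) : (2 <= M)%N ->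
  #|` hcball x n.+1 `\` hcball x n|%fset = (M ^ n * M.-1)%N.
Proof.
move=> M2; rewrite cardfsD (fsetIidPr _) ?hcball_sub// !card_hcball//.
by rewrite expnS -subn1 mulnBr muln1 mulnC.
Qed.

(** * Sums of nonnegative extended reals *)

Lemma esumZl (R : realType) (T : choiceType) (A : set T) (r : R)
    (f : T -> \bar R) :
  0 <= r -> (forall x, 0 <= f x)%E ->
  (\esum_(x in A) (r%:E * f x) = r%:E * \esum_(x in A) f x)%E.
Proof.
move=> r0 f0; rewrite /esum -ereal_supZl//; last first.
  by apply/set0P; exists (\sum_(x \in set0) f x)%E;
    exists set0 => //; exact: fsets_set0.
rewrite image_comp/=; congr ereal_sup; apply: eq_imagel => B _ /=.
by rewrite ge0_mule_fsumr.
Qed.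

Lemma esum_finite_support (R : realType) (T : choiceType) (A : {fset T})
    (f : T -> \bar R) :
  (forall x, 0 <= f x)%E -> (forall x, x \notin A -> f x = 0%E) ->
  (\esum_(x in [set: T]) f x = \sum_(x <- A) f x)%E.
Proof.
move=> f0 fA; rewrite (esumID [set` A])// !setTI [X in (_ + X)%E]esum1.
  by rewrite adde0 esum_fset// fsbig_finite//= set_fsetK.
by move=> x /= /negP /fA.
Qed.

(** * Ball indicators under a single jump *)

Section JumpProb.
Context (R : realType) (M : nat) (c : R).
Hypotheses (M2 : (2 <= M)%N) (c0 : 0 < c) (cM : c < M%:R).
Implicit Types (x y z : Omega M) (n s : nat).

Let M_gt0 : 0 < M%:R :> R. Proof. by rewrite ltr0n; case: M M2. Qed.
Let M1_gt0 : 0 < M%:R - 1 :> R. Proof. by rewrite subr_gt0 ltr1n. Qed.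
Let q_ge0 : 0 <= c / M%:R. Proof. by rewrite divr_ge0// ltW. Qed.
Let q_lt1 : c / M%:R < 1. Proof. by rewrite ltr_pdivrMr// mul1r. Qed.
Let predM : M.-1%:R = M%:R - 1 :> R.
Proof. by rewrite -subn1 natrB//; case: M M2. Qed.

Lemma jump_probE x y n : hdist x y = n.+1 ->
  jump_prob c x y = (1 - c / M%:R) * (c / M%:R) ^+ n / (M%:R ^+ n * (M%:R - 1)).
Proof.
move=> xy; rewrite /jump_prob -hdist_eq0 xy/= hsphereE card_hsphere//.
by rewrite natrM natrX predM.
Qed.

Lemma jump_prob_ge0 x y : 0 <= jump_prob c x y.
Proof.
case E : (hdist x y) => [|n].
  by rewrite /jump_prob -hdist_eq0 E.
rewrite (jump_probE E) divr_ge0// mulr_ge0 ?exprn_ge0//; try exact: ltW.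
by rewrite subr_ge0 ltW.
Qed.

(** With q = c/M, the sphere of radius n+1 carries mass (1 - q) q^n, and these masses telescope. *)
Lemma sum_jump_prob_hcball x n :
  \sum_(z <- hcball x n) jump_prob c x z = 1 - (c / M%:R) ^+ n.
Proof.
elim: n => [|n IH].
  rewrite expr0 subrr big_seq big1// => z.
  by rewrite in_hcball leqn0 hdist_eq0 /jump_prob => ->.
rewrite (big_fsetID _ (mem (hcball x n)))/=.
have -> : [fset z | z in hcball x n.+1 & z \in hcball x n]%fset = hcball x n.
  apply/fsetP => z; rewrite !inE !in_hcball andbC.
  by case: leqP => // /leqW ->.
rewrite IH.
have -> : [fset z | z in hcball x n.+1 & z \notin hcball x n]%fset
   = (hcball x n.+1 `\` hcball x n)%fset.
  by apply/fsetP => z; rewrite !inE andbC.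
rewrite big_seq (eq_bigr (fun=> (1 - c / M%:R) * (c / M%:R) ^+ n
    / (M%:R ^+ n * (M%:R - 1)))); last first.
  move=> z; rewrite in_fsetD !in_hcball -ltnNge => xz.
  by apply: jump_probE; apply/eqP; rewrite eqn_leq andbC.
rewrite -big_seq big_const_seq count_predT iter_addr_0 card_hsphere//.
rewrite -[X in _ + X]mulr_natr natrM natrX predM.
rewrite mulfVK ?mulf_neq0 ?expf_neq0 ?gt_eqF//.
by rewrite exprS; ring.
Qed.

Definition ball_indic s x : R := (hdist 0 x <= s)%N%:R.

(** The one-jump operator applied to the indicator of B_s. *)
Definition jump_ball s x : R := \sum_(z <- hcball 0 s) jump_prob c x z.

Lemma jump_ball_in s x : (hdist 0 x <= s)%N ->
  jump_ball s x = 1 - (c / M%:R) ^+ s.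
Proof. by move=> xs; rewrite /jump_ball (hcball_eq xs) sum_jump_prob_hcball. Qed.

(** All M^s points of B_s lie at the same distance n+1 from [x], by the isosceles property. *)
Lemma jump_ball_out s x n : hdist 0 x = n.+1 -> (s <= n)%N ->
  jump_ball s x =
  M%:R ^+ s * ((1 - c / M%:R) * (c / M%:R) ^+ n / (M%:R ^+ n * (M%:R - 1))).
Proof.
move=> xn sn; rewrite /jump_ball big_seq.
rewrite (eq_bigr (fun=> (1 - c / M%:R) * (c / M%:R) ^+ n
    / (M%:R ^+ n * (M%:R - 1)))); last first.
  move=> z; rewrite in_hcball => zs; apply: jump_probE.
  rewrite hdistC in xn.
  by rewrite (@hdist_ultra_eq _ x 0 z) xn// ltnS (leq_trans zs).
rewrite -big_seq big_const_seq count_predT iter_addr_0 card_hcball//.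
by rewrite -[LHS]mulr_natl natrX.
Qed.

Definition jump_eigenvalue s : R :=
  1 - (M%:R ^+ 2 - c) / (M%:R * (M%:R - 1)) * (c / M%:R) ^+ s.

(** The cases are |x| <= s, |x| = s+1 and |x| > s+1. In the last one both sides vanish: from [x] all
    points of B_{s+1} are equally likely, and B_{s+1} has M times as many points as B_s. *)
Lemma jump_ball_eigen s x :
  M%:R * jump_ball s x - jump_ball s.+1 x =
  jump_eigenvalue s * (M%:R * ball_indic s x - ball_indic s.+1 x).
Proof.
have Mn0 : M%:R != 0 :> R by rewrite gt_eqF.
have M1n0 : M%:R - 1 != 0 :> R by rewrite gt_eqF.
(* Expressed through q = c/M, b is (M - q)/(M - 1), so that [c] enters only through q and its
   powers. *)
have bE : (M%:R ^+ 2 - c) / (M%:R * (M%:R - 1)) = (M%:R - c / M%:R) / (M%:R - 1).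
  by field; rewrite Mn0 M1n0.
rewrite /ball_indic /jump_eigenvalue bE.
have [xs|] := leqP (hdist 0 x) s.
  rewrite (leqW xs) !jump_ball_in// ?(leqW xs)// exprS.
  move: (c / M%:R) => q; move: (q ^+ s) => qs.
  by rewrite !mulr1n; field.
case E : (hdist 0 x) => [//|n]; rewrite ltnS ltnS => sn.
rewrite (jump_ball_out E sn).
have [ns|ns] := leqP n s.
  have ns' : n = s by apply/eqP; rewrite eqn_leq ns.
  rewrite -ns' in E *; rewrite jump_ball_in ?E// exprS.
  move: (c / M%:R) => q; move: (q ^+ n) => qs.
  by rewrite ?mulr1n ?mulr0n; field; rewrite M1n0 expf_neq0.
rewrite (jump_ball_out E ns) exprS.
by rewrite ?mulr0n; ring.
Qed.

End JumpProb.

(** * Iterates of the jump operator *)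

Section JumpOperator.
Context (R : realType) (M : nat) (c : R).
Hypotheses (M2 : (2 <= M)%N) (c0 : 0 < c) (cM : c < M%:R).
Implicit Types (x y z : Omega M) (n s : nat) (f g : Omega M -> R).

(** [\esum] is a supremum of finite sums, so this is the one-jump operator only on nonnegative
    functions. *)
Definition jump_op f x : \bar R :=
  (\esum_(z in [set: Omega M]) (jump_prob c x z * f z)%:E)%E.

Let jp_ge0 x y : 0 <= jump_prob c x y. Proof. exact: jump_prob_ge0. Qed.

Lemma jump_op_lin (a b : R) f g x : 0 <= a -> 0 <= b ->
  (forall z, 0 <= f z) -> (forall z, 0 <= g z) ->
  jump_op (fun z => a * f z + b * g z) x =
   (a%:E * jump_op f x + b%:E * jump_op g x)%E.
Proof.
move=> a0 b0 f0 g0; rewrite /jump_op -!esumZl//;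
  try by move=> z; rewrite lee_fin mulr_ge0.
rewrite -esumD; [|by move=> z _; rewrite -EFinM lee_fin !mulr_ge0..].
by apply: eq_esum => z _; rewrite -!EFinM -EFinD mulrDr !(mulrCA (jump_prob _ _ _)).
Qed.

Lemma jump_op_indic s x : jump_op (ball_indic R s) x = (jump_ball c s x)%:E.
Proof.
rewrite /jump_op (@esum_finite_support _ _ (hcball 0 s)).
- rewrite sumEFin; congr _%:E; rewrite /jump_ball !big_seq.
  by apply: eq_bigr => z; rewrite in_hcball /ball_indic => ->; rewrite mulr1.
- by move=> z; rewrite lee_fin mulr_ge0// ler0n.
- by move=> z; rewrite in_hcball /ball_indic => /negbTE ->; rewrite mulr0.
Qed.

(** Any finite set of targets lies in a ball around [x], whose total jump probability 1 - q^n is at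
    most 1. *)
Lemma jump_op_le1 f x : (forall z, 0 <= f z <= 1) -> (jump_op f x <= 1)%E.
Proof.
move=> f01; apply: ge_ereal_sup => _ /= [A [finA _] <-].
rewrite fsbig_finite//=.
pose n := (\max_(z <- fset_set A) hdist x z)%N.
rewrite sumEFin lee_fin.
have q0 : 0 <= c / M%:R by rewrite divr_ge0// ltW.
apply: (@le_trans _ _ (\sum_(z <- hcball x n) jump_prob c x z)); last first.
  by rewrite sum_jump_prob_hcball// lerBlDr lerDl exprn_ge0.
apply: (@le_trans _ _ (\sum_(z <- fset_set A) jump_prob c x z)).
  apply: ler_sum => z _; have /andP[_ f1] := f01 z.
  by rewrite ler_piMr.
rewrite -lee_fin -!sumEFin; apply: lee_sum_nneg_subfset => [z zA|z _ _].
  by rewrite in_hcball; exact: leq_bigmax_seq.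
by rewrite lee_fin.
Qed.

Lemma jump_prob_iter_ge0 n x y : (0 <= jump_prob_iter c n x y)%E.
Proof.
elim: n x => [|n IH] x /=; first by rewrite lee_fin ler0n.
by apply: esum_ge0 => z _; rewrite mule_ge0// lee_fin.
Qed.

(** The probability that the walk started at [x] is in B_s after n jumps. *)
Definition ball_iter n s x : \bar R :=
  (\sum_(y <- hcball 0 s) jump_prob_iter c n x y)%E.

Lemma ball_iterS n s x : ball_iter n.+1 s x =
  (\esum_(z in [set: Omega M]) ((jump_prob c x z)%:E * ball_iter n s z))%E.
Proof.
rewrite /ball_iter/= -esum_sum => [|z y _ _].
  apply: eq_esum => z _; rewrite ge0_sume_distrr// => y _.
  exact: jump_prob_iter_ge0.
by rewrite mule_ge0 ?jump_prob_iter_ge0// lee_fin.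
Qed.

Lemma ball_iter0 s x : ball_iter 0 s x = (ball_indic R s x)%:E.
Proof.
rewrite /ball_iter/= sumEFin /ball_indic -in_hcball; congr _%:E.
have [xs|xs] := boolP (x \in hcball 0 s).
  rewrite (big_fsetD1 x)//= eqxx big_seq big1 ?addr0// => y.
  by rewrite !inE => /andP[]; rewrite eq_sym => /negbTE ->.
by rewrite big_seq big1// => y ys; case: eqVneq xs => // ->; rewrite ys.
Qed.

Lemma ball_iter_itv n s x : (0 <= ball_iter n s x <= 1)%E.
Proof.
elim: n x => [|n IH] x.
  by rewrite ball_iter0 !lee_fin /ball_indic ler0n lern1 leq_b1.
apply/andP; split; first by apply: sume_ge0 => y _; exact: jump_prob_iter_ge0.
(* [jump_op] takes real functions; the induction hypothesis provides the finiteness. *)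
have fE z : (fine (ball_iter n s z))%:E = ball_iter n s z.
  have /andP[b0 b1] := IH z; rewrite fineK// ge0_fin_numE//.
  by rewrite (le_lt_trans b1)// ltry.
rewrite ball_iterS.
apply: le_trans (@jump_op_le1 (fun z => fine (ball_iter n s z)) x _).
  by apply: le_esum => z _; rewrite EFinM fE.
by move=> z; rewrite -!lee_fin fE.
Qed.

Definition ball_prob n s x : R := fine (ball_iter n s x).

Lemma ball_probE n s x : ball_iter n s x = (ball_prob n s x)%:E.
Proof.
have /andP[b0 b1] := ball_iter_itv n s x; rewrite /ball_prob fineK// ge0_fin_numE//.
by rewrite (le_lt_trans b1)// ltry.
Qed.

Lemma ball_prob_itv n s x : 0 <= ball_prob n s x <= 1.
Proof. by rewrite -!lee_fin -ball_probE ball_iter_itv. Qed.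

Lemma ball_prob_ge0 n s x : 0 <= ball_prob n s x.
Proof. by have /andP[] := ball_prob_itv n s x. Qed.

Lemma ball_probS n s x : (ball_prob n.+1 s x)%:E = jump_op (ball_prob n s) x.
Proof.
rewrite -ball_probE ball_iterS; apply: eq_esum => z _.
by rewrite ball_probE EFinM.
Qed.

Lemma ball_prob_eigen n s x :
  M%:R * ball_prob n s x - ball_prob n s.+1 x =
  jump_eigenvalue M c s ^+ n * (M%:R * ball_indic R s x - ball_indic R s.+1 x).
Proof.
elim: n x => [|n IH] x.
  by rewrite expr0 mul1r /ball_prob !ball_iter0.
(* [jump_op] sums in [\bar R], so the signed identity is padded with multiples
   of [L] to have nonnegative functions on both sides. *)
set l := _ ^+ n.+1; pose l' := jump_eigenvalue M c s ^+ n; pose L := `|l'|.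
have lL : 0 <= L - l' by rewrite subr_ge0 ler_norm.
have Ll : 0 <= L + l' by rewrite addrC -lerBlDr sub0r lerNnormlW// ler_norm.
have L0 : 0 <= L by exact: normr_ge0.
have ind0 k z : 0 <= ball_indic R k z by exact: ler0n.
(* Here f2 - f1 is l' (M 1_{B_s} - 1_{B_{s+1}}). The absolute value in [L] matters since eigenvalues
   can be negative: b > 1 makes the one for s = 0 so. *)
pose f1 z := L * M%:R * ball_indic R s z + L * ball_indic R s.+1 z.
pose f2 z := (L + l') * M%:R * ball_indic R s z + (L - l') * ball_indic R s.+1 z.
have f10 z : 0 <= f1 z by rewrite addr_ge0// !mulr_ge0.
have f20 z : 0 <= f2 z by rewrite addr_ge0// !mulr_ge0.
have : jump_op (fun z => M%:R * ball_prob n s z + 1 * f1 z) x =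
       jump_op (fun z => 1 * ball_prob n s.+1 z + 1 * f2 z) x.
  congr jump_op; apply/funext => z; have := IH z; rewrite -/l' /f1 /f2; lra.
rewrite (jump_op_lin _ (ler0n _ M) ler01)//; [|exact: ball_prob_ge0].
rewrite (jump_op_lin _ ler01 ler01)//; [|exact: ball_prob_ge0].
rewrite !(@jump_op_lin _ _ (ball_indic R s) (ball_indic R s.+1))//;
  [|exact: mulr_ge0..].
rewrite !jump_op_indic// -!ball_probS.
rewrite -!EFinM -!EFinD => -[].
move=> h; rewrite /l exprS mulrAC -(jump_ball_eigen c M2) mulrC -/l'.
move: h; move: (jump_ball _ s x) (jump_ball _ s.+1 x) => J J'; lra.
Qed.
End JumpOperator.

(** * Poisson series *)

Lemma eseries_EFin (R : realType) (u : R^nat) (l : R) :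
  series u @ \oo --> l -> (\sum_(0 <= n <oo) (u n)%:E = l%:E)%E.
Proof.
move=> ul; apply/cvg_lim => //.
rewrite (_ : (fun n => _) = EFin \o series u); last first.
  by apply/funext => n /=; rewrite sumEFin seriesEnat.
exact: cvg_comp ul _.
Qed.

(** Brings nonnegative extended series back to the reals, where they can be subtracted. *)
Lemma cvg_series_fine (R : realType) (u : R^nat) (l : R) :
  (forall n, 0 <= u n) -> (\sum_(0 <= n <oo) (u n)%:E = l%:E)%E ->
  series u @ \oo --> l.
Proof.
move=> u0 ul; have /cvg_ex[l' ul'] : cvgn (series u).
  by apply: nnseries_is_cvg => //; rewrite ul ltry.
by have := eseries_EFin ul'; rewrite ul => -[->].
Qed.

Definition poisson_weight (R : realType) (n : nat) (t : R) : R :=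
  expR (- t) * (t ^+ n / n`!%:R).

Lemma poisson_weight_ge0 (R : realType) n (t : R) : 0 <= t ->
  0 <= poisson_weight n t.
Proof. by move=> t0; rewrite mulr_ge0 ?expR_ge0// divr_ge0// exprn_ge0. Qed.

(** The Poisson generating function. It is a real series because [a] will be an eigenvalue of either
    sign. *)
Lemma cvg_series_poisson (R : realType) (t a : R) :
  series (fun n => poisson_weight n t * a ^+ n) @ \oo --> expR (- (t * (1 - a))).
Proof.
have -> : expR (- (t * (1 - a))) = expR (- t) * expR (t * a).
  by rewrite -expRD; congr expR; ring.
rewrite (_ : series _ = fun n => expR (- t) * series (exp_coeff (t * a)) n).
  by apply: cvgMl_tmp; exact: is_cvg_series_exp_coeff.
apply/funext => n; rewrite !seriesEnat mulr_sumr; apply: eq_bigr => i _.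
by rewrite /poisson_weight /exp_coeff/= exprMn; ring.
Qed.

Lemma eseries_poisson (R : realType) (t : R) :
  (\sum_(0 <= n <oo) (poisson_weight n t)%:E = 1)%E.
Proof.
have := @cvg_series_poisson R t 1; rewrite subrr mulr0 oppr0 expR0 => /eseries_EFin <-.
by apply: eq_eseriesr => n _; rewrite expr1n mulr1.
Qed.

(** * The semigroup on ball indicators *)

Section Semigroup.
Context (R : realType) (M : nat) (c : R).
Hypotheses (M2 : (2 <= M)%N) (c0 : 0 < c) (cM : c < M%:R).
Implicit Types (x y z : Omega M) (n s : nat) (t : R).

Lemma sum_indic_hball s (g : Omega M -> R) :
  \sum_(y \in [set: Omega M]) g y * indic_hball R M s y =
  \sum_(y <- hcball 0 s) g y.
Proof.
have iE y : indic_hball R M s y = (y \in hcball 0 s)%:R :> R.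
  by rewrite in_hcball/= indicE; congr (nat_of_bool _)%:R; apply/idP/idP => [/set_mem|?];
    rewrite ?inE /hball/= hdistC.
rewrite (fsbigTE (hcball 0 s)) => [|y /negbTE ys]; last by rewrite iE ys mulr0.
by rewrite !big_seq; apply: eq_bigr => y ys; rewrite iE ys mulr1.
Qed.

Lemma semigroup_indicE s t x : 0 <= t ->
  (semigroup c t (indic_hball R M s) x)%:E =
  (\sum_(0 <= n <oo) (poisson_weight n t * ball_prob c n s x)%:E)%E.
Proof.
move=> t0; rewrite /semigroup sum_indic_hball.
have w0 n : (0 <= (poisson_weight n t)%:E)%E by rewrite lee_fin poisson_weight_ge0.
have p0 := jump_prob_iter_ge0 M2 c0 cM.
transitivity (\sum_(y <- hcball 0 s)
    \sum_(0 <= n <oo) ((poisson_weight n t)%:E * jump_prob_iter c n x y))%E.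
  have wp0 n y : (0 <= (poisson_weight n t)%:E * jump_prob_iter c n x y)%E.
    by rewrite mule_ge0.
  rewrite -sumEFin !big_seq; apply: eq_bigr => y ys; rewrite fineK//.
  (* [fine] in [transition_prob] loses nothing: each n-jump probability is at most 1, so the Poisson
     weights, of sum 1, dominate the series. *)
  rewrite ge0_fin_numE; last by apply: nneseries_ge0 => n _ _; exact: wp0.
  apply: (@le_lt_trans _ _ 1%E); last exact: ltry.
  rewrite -(eseries_poisson t); apply: lee_nneseries => n; first by move=> _ _; exact: wp0.
  move=> _; rewrite -[leRHS]mule1; apply: (lee_wpmul2l (w0 n)).
  have /andP[_] := ball_iter_itv M2 c0 cM n s x; apply: le_trans.
  by rewrite /ball_iter (big_fsetD1 y)//= leeDl// sume_ge0.
rewrite -nneseries_sum => [|y n _]; last by rewrite mule_ge0.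
apply: eq_eseriesr => n _; rewrite [RHS]EFinM -(ball_probE M2 c0 cM) /ball_iter.
by rewrite ge0_sume_distrr.
Qed.

Lemma cvg_semigroup s t x : 0 <= t ->
  series (fun n => poisson_weight n t * ball_prob c n s x) @ \oo -->
  semigroup c t (indic_hball R M s) x.
Proof.
move=> t0; apply: cvg_series_fine; last by rewrite semigroup_indicE.
by move=> n; rewrite mulr_ge0 ?poisson_weight_ge0 ?ball_prob_ge0.
Qed.

Lemma semigroup_ge0 s t x : 0 <= t -> 0 <= semigroup c t (indic_hball R M s) x.
Proof.
move=> t0; rewrite -lee_fin semigroup_indicE//; apply: nneseries_ge0 => n _ _.
by rewrite lee_fin mulr_ge0 ?poisson_weight_ge0 ?ball_prob_ge0.
Qed.

Lemma semigroup_le1 s t x : 0 <= t -> semigroup c t (indic_hball R M s) x <= 1.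
Proof.
move=> t0; rewrite -lee_fin semigroup_indicE// -(eseries_poisson t).
apply: lee_nneseries => n.
  by rewrite lee_fin mulr_ge0 ?poisson_weight_ge0 ?ball_prob_ge0.
have /andP[_ p1] := ball_prob_itv M2 c0 cM n s x.
by move=> _; rewrite lee_fin ler_piMr// poisson_weight_ge0.
Qed.

(** The Poisson mixture of [ball_prob_eigen] over n. Both sides are limits of partial sums that
    agree term by term. *)
Lemma semigroup_eigen s t x : 0 <= t ->
  M%:R * semigroup c t (indic_hball R M s) x -
    semigroup c t (indic_hball R M s.+1) x =
  expR (- (t * (1 - jump_eigenvalue M c s))) *
    (M%:R * ball_indic R s x - ball_indic R s.+1 x).
Proof.
move=> t0.
have h1 := cvgB (cvgM (cvg_cst (M%:R : R)) (@cvg_semigroup s t x t0))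
  (@cvg_semigroup s.+1 t x t0).
have h2 := cvgM (@cvg_series_poisson R t (jump_eigenvalue M c s))
  (cvg_cst (M%:R * ball_indic R s x - ball_indic R s.+1 x)).
have [<- <-] := (cvg_lim (@Rhausdorff R) (h1 _ _ _), cvg_lim (@Rhausdorff R) (h2 _ _)).
congr (lim (_ @ \oo)); apply/funext => n.
rewrite /= !fctE !seriesEnat /= mulr_suml mulr_sumr -sumrB; apply: eq_bigr => i _.
rewrite mulrCA -mulrBr (ball_prob_eigen M2 c0 cM); ring.
Qed.

(** H_s(t) of the sketch, whose integral over t is the pairing of the potential of 1_{B_s} with
    1_{B_m}. *)
Definition ball_overlap s m t : R :=
  \sum_(x <- hcball 0 m) semigroup c t (indic_hball R M s) x.

Lemma sum_ball_indic s m :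
  \sum_(x <- hcball (0 : Omega M) m) ball_indic R s x = M%:R ^+ minn s m :> R.
Proof.
have ball0 n (y : Omega M) : (y \in hcball 0 n) = (hdist 0 y <= n)%N by exact: in_hcball.
rewrite -natrX -(card_hcball (0 : Omega M))// -sum1_size natr_sum /=.
have [sm|ms] := leqP s m; last first.
  rewrite !big_seq; apply: eq_bigr => y; rewrite ball0 /ball_indic => ym.
  by rewrite (leq_trans ym)// ltnW.
rewrite [RHS]big_seq [RHS](eq_bigr (ball_indic R s)); last first.
  by move=> y; rewrite ball0 /ball_indic => ->.
rewrite -[RHS]big_seq; apply/esym/big_fset_incl; first exact: hcball_sub.
by move=> y _; rewrite ball0 /ball_indic => /negbTE ->.
Qed.

(** On t >= 0 the semigroup is a series of nonnegative measurable functions of t. *)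
Lemma measurable_semigroup s x :
  measurable_fun (`[0, +oo[ : set (measurableTypeR R))
    (fun t => (semigroup c t (indic_hball R M s) x)%:E).
Proof.
apply: (eq_measurable_fun (fun t =>
  (\sum_(0 <= n <oo) (poisson_weight n t * ball_prob c n s x)%:E)%E)).
  by move=> t; rewrite inE/= in_itv/= andbT => t0; rewrite semigroup_indicE.
apply: ge0_emeasurable_sum => [n t|n _].
  rewrite /= in_itv/= andbT => t0 _.
  by rewrite lee_fin mulr_ge0 ?poisson_weight_ge0 ?ball_prob_ge0.
apply/measurable_EFinP; apply: measurable_funM => //.
apply: measurable_funM.
  by apply: measurableT_comp => //; exact: measurable_oppr.
by apply: measurable_funM => //; exact: exprn_measurable.
Qed.
End Semigroup.

(** * Integration over time *)

Lemma integral_expRN (R : realType) (k a : R) : 0 <= k -> 0 < a ->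
  (\int[lebesgue_measure]_(t in `[0%R, +oo[) (k * expR (- (t * a)))%:E =
   (k / a)%:E)%E.
Proof.
move=> k0 a0; pose F t : R := - (k / a) * expR (- (t * a)).
have dF (t : R) : is_derive t 1 F (k * expR (- (t * a))).
  apply: is_derive_eq.
  rewrite /GRing.scale/=; field; exact: lt0r_neq0.
have cE (b : R) : continuous (fun t : R => b * expR (- (t * a))).
  by move=> t; apply/differentiable_continuous/derivable1_diffP.
rewrite (@ge0_continuous_FTC2y _ _ F _ 0).
- by rewrite /F mul0r oppr0 expR0 mulr1 sub0e -EFinN opprK.
- by move=> t _; rewrite mulr_ge0 ?expR_ge0.
- exact: continuous_subspaceT.
- rewrite -(mulr0 (- (k / a))); apply: cvgM; first exact: cvg_cst.
  apply: (@cvg_comp _ _ _ (fun t => t * a) (fun z => expR (- z)) _ (pinfty_nbhs R)).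
    exact: gt0_cvgMly.
  exact: cvgr_expR.
- by move=> t _; case: (dF t).
- by apply: cvg_at_right_filter; exact: cE.
- by move=> t _; rewrite derive1E; case: (dF t).
Qed.

Section Overlap.
Context (R : realType) (M : nat) (c : R).
Hypotheses (M2 : (2 <= M)%N) (c0 : 0 < c) (cM : c < M%:R).
Implicit Types (s m : nat) (t : R).

Let M_gt0 : 0 < M%:R :> R. Proof. by rewrite ltr0n; case: M M2. Qed.
Let M1_gt0 : 0 < M%:R - 1 :> R. Proof. by rewrite subr_gt0 ltr1n. Qed.

Definition jump_gap s : R := 1 - jump_eigenvalue M c s.

(** Sum the eigenvector over B_m: for m <= s it is constantly M - 1 there, while for s < m its total
    M * M^s - M^(s+1) is zero. *)
Lemma ball_overlap_step s m t : 0 <= t ->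
  M%:R * ball_overlap M c s m t - ball_overlap M c s.+1 m t =
  expR (- (t * jump_gap s)) * (if (m <= s)%N then (M%:R - 1) * M%:R ^+ m else 0).
Proof.
move=> t0; rewrite /ball_overlap mulr_sumr -sumrB.
under eq_bigr do rewrite (semigroup_eigen M2 c0 cM)//.
rewrite -mulr_sumr sumrB -mulr_sumr !(sum_ball_indic _ M2); congr (_ * _).
have [ms|sm] := leqP m s.
  by rewrite (minn_idPr (leqW ms)); ring.
by rewrite (minn_idPl sm) exprS subrr.
Qed.

Lemma ball_overlap_itv s m t : 0 <= t -> 0 <= ball_overlap M c s m t <= M%:R ^+ m.
Proof.
move=> t0; apply/andP; split; first by apply: sumr_ge0 => x _;
  exact: semigroup_ge0.
rewrite -natrX -(card_hcball (0 : Omega M) m M2) -sum1_size natr_sum.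
by apply: ler_sum => x _; exact: semigroup_le1.
Qed.

(** The coefficient of exp(-t b q^k) for k = max(s,m) + i; the quotient stands for the negative
    power M^(m-k-1). *)
Definition overlap_coef s m i : R :=
  M%:R ^+ s * ((M%:R - 1) * M%:R ^+ m / M%:R ^+ (maxn s m + i).+1).

Lemma cvg_ball_overlap s m t : 0 <= t ->
  series (fun i => overlap_coef s m i * expR (- (t * jump_gap (maxn s m + i)))) @ \oo
  --> ball_overlap M c s m t.
Proof.
(* Dividing by M^i turns [ball_overlap_step] into a formula for consecutive differences. *)
move=> t0; pose a i := ball_overlap M c i m t / M%:R ^+ i.
have aS i : a i - a i.+1 =
    expR (- (t * jump_gap i)) * (if (m <= i)%N then (M%:R - 1) * M%:R ^+ m else 0)
    / M%:R ^+ i.+1.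
  rewrite -ball_overlap_step// /a exprS; field.
  by rewrite expf_neq0 gt_eqF.
set p := maxn s m.
(* Differences at indices below m vanish, so the telescoping can start at max(s,m). *)
have ap : a s = a p.
  have [ms|sm] := leqP m s; first by rewrite /p (maxn_idPl ms).
  have -> : p = (s + (m - s))%N.
    by rewrite subnKC ?(ltnW sm)// /p (maxn_idPr (ltnW sm)).
  have : (m - s <= m - s)%N by [].
  elim: {1 3}(m - s)%N => [|k IH] km; first by rewrite addn0.
  rewrite (IH (ltnW km)); apply/eqP; rewrite -subr_eq0 addnS aS leqNgt.
  by rewrite -ltn_subRL km mulr0 mul0r.
have -> : ball_overlap M c s m t = M%:R ^+ s * (a p - 0).
  by rewrite subr0 -ap /a mulrC divfK// expf_neq0// gt_eqF.
rewrite (_ : series _ = fun n => M%:R ^+ s * (a p - a (p + n)%N)); last first.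
  apply/funext => n; rewrite seriesEnat/= /overlap_coef.
  rewrite (telescope_sumr_eq (fun i => - (M%:R ^+ s * a (p + i)%N)))//.
    by rewrite addn0; ring.
  move=> i _; rewrite opprK addnS [RHS]addrC -[RHS]mulrBr aS.
  rewrite (leq_trans (leq_maxr s m) (leq_addr _ _)).
  by rewrite -/p; ring.
apply: cvgM; first exact: cvg_cst.
apply: cvgB; first exact: cvg_cst.
(* The remainder a(p+n) tends to 0: the overlap is at most M^m, while the divisor is at least
   M^n. *)
apply: (@squeeze_cvgr _ _ _ _ (cst 0) (geometric (M%:R ^+ m) (M%:R^-1))).
- apply: nearW => n; have /andP[h0 h1] := ball_overlap_itv (p + n) m t0.
  rewrite /= /a divr_ge0 ?exprn_ge0//=.
  rewrite ler_pM ?invr_ge0 ?exprn_ge0// exprVn lef_pV2 ?posrE ?exprn_gt0//.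
  by rewrite ler_eXn2l ?ltr1n// leq_addl.
- exact: cvg_cst.
- apply: cvg_geometric; rewrite ger0_norm ?invr_ge0// invf_lt1//.
  by rewrite ltr1n.
Qed.
Lemma jump_gapE s : jump_gap s =
  (M%:R ^+ 2 - c) / (M%:R * (M%:R - 1)) * (c / M%:R) ^+ s.
Proof. by rewrite /jump_gap /jump_eigenvalue subKr. Qed.

Lemma jump_gap_coef_gt0 : 0 < (M%:R ^+ 2 - c) / (M%:R * (M%:R - 1)).
Proof.
rewrite divr_gt0 ?mulr_gt0// subr_gt0 (lt_le_trans cM)// expr2 ler_peMl ?ltW//.
by rewrite ltr1n.
Qed.

Lemma jump_gap_gt0 s : 0 < jump_gap s.
Proof. by rewrite jump_gapE mulr_gt0 ?jump_gap_coef_gt0// exprn_gt0// divr_gt0. Qed.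

Lemma overlap_coef_ge0 s m i : 0 <= overlap_coef s m i.
Proof. by rewrite mulr_ge0 ?exprn_ge0// divr_ge0 ?mulr_ge0 ?exprn_ge0// ltW. Qed.

(** Integrating termwise divides the k-th coefficient by b q^k. The powers M^k cancel and c^(-k)
    remains, which is summable because c > 1. *)
Lemma integral_ball_overlap s m : 1 < c ->
  (\int[lebesgue_measure]_(t in `[0%R, +oo[) (ball_overlap M c s m t)%:E =
   ((M%:R - 1) / (M%:R * ((M%:R ^+ 2 - c) / (M%:R * (M%:R - 1))))
     * (c / (c - 1)) * M%:R ^+ minn s m * (M%:R / c) ^+ maxn s m)%:E)%E.
Proof.
move=> c1; set b := (M%:R ^+ 2 - c) / _; set p := maxn s m.
have b0 : 0 < b by exact: jump_gap_coef_gt0.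
transitivity (\int[lebesgue_measure]_(t in `[0%R, +oo[)
    (\sum_(0 <= i <oo)
       (overlap_coef s m i * expR (- (t * jump_gap (p + i))))%:E))%E.
  apply: eq_integral => t; rewrite inE/= in_itv/= andbT => t0.
  by rewrite (eseries_EFin (@cvg_ball_overlap s m t t0)).
rewrite integral_nneseries//=; last 2 first.
- move=> i; apply/measurable_EFinP; apply: measurable_funM => //.
  apply: measurableT_comp => //; apply: measurableT_comp => //.
  exact: measurable_funM.
- by move=> i t _; rewrite lee_fin mulr_ge0 ?expR_ge0 ?overlap_coef_ge0.
rewrite (eq_eseriesr (fun i _ =>
  integral_expRN (overlap_coef_ge0 s m i) (jump_gap_gt0 (p + i)))).
have c_norm : `|c^-1| < 1 by rewrite ger0_norm ?invr_ge0 ?(ltW c0)// invf_lt1.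
(* The term at k = p, which starts the geometric series; s + m splits below into minimum plus
   maximum. *)
pose K : R := M%:R ^+ (s + m) * (M%:R - 1) / (M%:R * b) / c ^+ p.
rewrite (eseries_EFin (l := K * (1 - c^-1)^-1)).
  congr _%:E; rewrite /K expr_div_n -(addn_min_max s m) exprD -/p; field.
  by rewrite expf_neq0 ?gt_eqF// subr_gt0.
rewrite (_ : (fun _ => _) = geometric K c^-1).
  exact: cvg_geometric_series.
apply/funext => i; rewrite /= /K /overlap_coef jump_gapE -/b -/p.
rewrite expr_div_n exprVn exprS !exprD.
by field; rewrite !expf_neq0 ?gt_eqF.
Qed.

Lemma pairing_potential s m : 1 < c ->
  pairing (potential c (indic_hball R M s)) (indic_hball R M m) =
  (M%:R - 1) / (M%:R * ((M%:R ^+ 2 - c) / (M%:R * (M%:R - 1)))) * (c / (c - 1))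
     * M%:R ^+ minn s m * (M%:R / c) ^+ maxn s m.
Proof.
move=> c1; rewrite /pairing sum_indic_hball.
pose I x := (\int[lebesgue_measure]_(t in `[0%R, +oo[)
  (semigroup c t (indic_hball R M s) x)%:E)%E.
have itv0 (t : R) : `[0, +oo[%classic t -> 0 <= t by rewrite /= in_itv/= andbT.
have I0 x : (0 <= I x)%E.
  by apply: integral_ge0 => t /itv0 t0; rewrite lee_fin semigroup_ge0.
have := integral_ball_overlap s m c1.
under eq_integral do rewrite /ball_overlap -sumEFin.
rewrite ge0_integral_sum//; last 2 first.
- by move=> x; exact: measurable_semigroup.
- by move=> x t /itv0 t0; rewrite lee_fin semigroup_ge0.
move=> sumI.
apply: EFin_inj; rewrite -sumI -sumEFin big_seq [RHS]big_seq; apply: eq_bigr => x xm.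
(* The real integral is a [fine], so each integral must be finite: it is one of finitely many
   nonnegative terms with finite sum. *)
rewrite /potential /Rintegral fineK// ge0_fin_numE//; last exact: I0.
apply: (@le_lt_trans _ _ (\sum_(x <- hcball 0 m) I x)%E); last by rewrite sumI ltry.
by rewrite (big_fsetD1 x)//= leeDl// sume_ge0.
Qed.

End Overlap.

(** * Covariance of the ball process *)

Theorem theorem2p21 (R : realType) (M : nat) (c : R)
    (d : measure_display) (T : measurableType d) (P : probability T R)
    (X : {nonneg R} -> T -> Bb_dual R M) :
  (2 <= M)%N -> 1 < c -> c < M%:R ->
  centered_gaussian_dual_process P X ->
  (forall (s t : {nonneg R}) (phi psi : Bb R M),
     ('E_P[fun w => (X s w phi * X t w psi)%R])%E =
     (2 * Num.min s%:num t%:num * pairing (potential c phi) psi)%:E) ->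
  let b : R := (M%:R ^+ 2 - c) / (M%:R * (M%:R - 1)) in
  let D : R := (M%:R - 1) / (M%:R * b) * (c / (c - 1)) in
  let theta : nat -> T -> R := fun t w => X 1%:nng w (indic_hball R M t) in
  centered_gaussian_process P theta /\
  (forall s t : nat,
     ('E_P[fun w => (theta s w * theta t w)%R])%E =
     (2 * D * M%:R ^+ minn s t * (M%:R / c) ^+ maxn s t)%:E).
Proof.
move=> M2 c1 cM [gX mX] cov b D theta; split.
  (* [theta] is the Gaussian family re-indexed along t -> (1, 1_{B_t}). *)
  split=> [n i a|i]; first exact: (gX n (fun k => (1%:nng, indic_hball R M (i k))) a).
  exact: (mX (1%:nng, indic_hball R M i)).
move=> s t; rewrite cov minxx /= mulr1 pairing_potential//; last exact: lt_trans c1.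
by congr _%:E; rewrite !mulrA.
Qed.
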